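(* Let $P_n$ denote the path on $n$ vertices. Then $\lim_{n\to\infty}\mathcal{I}(P_n)=\frac{2r+2}{2r+3}$, where $r=\sqrt[3]{\frac{9+\sqrt{69}}{18}}+\sqrt[3]{\frac{9-\sqrt{69}}{18}}$ is the plastic number, the unique real root of $x^3=x+1$.
   Context: For a finite simple graph $G$: a matching is a set of pairwise vertex-disjoint edges; it is maximal if not contained in a larger matching. $\nu(G)$ is the maximum matching size, $\mathcal{T}_0(G)$ the number of maximal matchings, $\mathcal{T}_1(G)$ the sum of the sizes of all maximal matchings, and $\mathcal{I}(G)=\frac{\mathcal{T}_1(G)}{\nu(G)\mathcal{T}_0(G)}$ (equal to $1$ by convention if $\nu(G)=0$). *)

(* Defs.v *)
From HB Require Import structures.
From mathcomp Require Import all_boot all_order all_algebra.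
From mathcomp Require Import all_classical all_reals all_analysis.

Set Implicit Arguments.
Unset Strict Implicit.
Unset Printing Implicit Defensive.

Import Order.TTheory GRing.Theory Num.Theory.
Import numFieldNormedType.Exports.
Local Open Scope ring_scope.

Record sgraph := SGraph {
  vertex : finType;
  adj : rel vertex;
  adj_sym : symmetric adj;
  adj_irrefl : irreflexive adj
}.

Section Matchings.
Variable G : sgraph.

Definition edges : {set {set vertex G}} :=
  [set [set p.1; p.2] | p : vertex G * vertex G & adj p.1 p.2]%SET.

(* [finset.trivIset] is qualified because [classical_sets] shadows it. *)
Definition matching (M : {set {set vertex G}}) : bool :=
  (M \subset edges) && finset.trivIset M.

Definition maximal_matching (M : {set {set vertex G}}) : bool :=
  maxset matching M.

Definition nu : nat :=
  (\max_(M : {set {set vertex G}} | matching M) #|M|)%N.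

Definition T0 : nat := #|[set M | maximal_matching M]%SET|.

Definition T1 : nat :=
  (\sum_(M : {set {set vertex G}} | maximal_matching M) #|M|)%N.

Definition Iratio (R : realType) : R :=
  if nu == 0%N then 1 else T1%:R / (nu%:R * T0%:R).

End Matchings.

Section Path.
Variable n : nat.

Definition path_adj : rel 'I_n :=
  [rel i j : 'I_n | (i.+1 == j :> nat) || (j.+1 == i :> nat)].

Lemma path_adj_sym : symmetric path_adj.
Proof. by move=> i j; rewrite /path_adj /= orbC. Qed.

Lemma path_adj_irrefl : irreflexive path_adj.
Proof. by move=> i; rewrite /path_adj /= orbb gtn_eqF. Qed.

Definition path_graph : sgraph := SGraph path_adj_sym path_adj_irrefl.

End Path.

(* [x `^ 3^-1] is the real cube root for [x >= 0]; both radicands are positive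
   since 69 < 81. *)
Definition plastic (R : realType) : R :=
  ((9 + Num.sqrt 69) / 18) `^ 3^-1 + ((9 - Num.sqrt 69) / 18) `^ 3^-1.

(* Main.v *)
Require Import Defs.
From HB Require Import structures.
From mathcomp Require Import all_boot all_order all_algebra.
From mathcomp Require Import all_classical all_reals all_analysis.
From mathcomp Require Import zify ring lra.

Set Implicit Arguments.
Unset Strict Implicit.
Unset Printing Implicit Defensive.

Import Order.TTheory GRing.Theory Num.Theory.
Import numFieldNormedType.Exports.
Local Open Scope classical_set_scope.
Local Open Scope ring_scope.

(* A maximal matching of a path starts with its first or its second edge, and
   what follows is an arbitrary maximal matching of the remaining path on
   [n - 2] or [n - 3] vertices. Hence [T0] satisfies [t (n+3) = t (n+1) + t n],
   and [T1] the same recurrence with the inhomogeneous term [t (n+1) + t n].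
   With [c = (r + 1) / (2 r + 3)], the error [T1 - c n T0] satisfies the same
   recurrence up to a multiple of [t (n+1) - r t n], which is bounded because
   the two other roots of [x^3 = x + 1] lie in the unit disc; so the error is
   [O(T0)]. As [nu] is [n / 2] rounded down, the ratio tends to [2 c]. *)

(** * Bit strings that encode maximal matchings of a path *)

Section Good.
Local Open Scope nat_scope.

(* Bit [i] tells whether the edge between vertices [i] and [i.+1] is selected:
   no two consecutive bits are set, and no three consecutive bits are all
   unset; [a] and [b] are the two bits that precede [s]. The initial state
   [true, false] stands for an unselected edge that is already blocked. *)
Fixpoint good (a b : bool) (s : bitseq) : bool :=
  if s is c :: s' then [&& ~~ (b && c), [|| a, b | c] & good b c s']
  else a || b.

(** Unrolls the recursion into conditions on positions. At [i = size s] the default [false] acts as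
    an unset bit past the end, so the last two bits cannot both be unset. *)
Lemma goodP (a b : bool) (s : bitseq) :
  reflect ((forall i, i < size s -> ~~ (nth false (b :: s) i && nth false s i)) /\
           (forall i, i <= size s ->
              [|| nth false [:: a, b & s] i, nth false (b :: s) i
                | nth false s i]))
          (good a b s).
Proof.
elim: s a b => [|c s IH] a b /=.
  apply: (iffP idP) => [ab|[_ /(_ 0 isT)]]; last by rewrite /= orbF.
  by split=> // -[|i] //= _; rewrite orbF.
apply: (iffP and3P) => [[bc abc /IH[indep dom]]|[indep dom]].
  by split=> -[|i] //= /ltnSE ?; [exact: indep|exact: dom].
split; [exact: (indep 0)|exact: (dom 0)|].
apply/IH; split=> i lti; [exact: (indep i.+1)|exact: (dom i.+1)].
Qed.

(** The weight [f] treats both counts at once: the constant 1 gives [T0], the identity gives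
    [T1]. *)
Definition good_sum (f : nat -> nat) (a b : bool) (m : nat) : nat :=
  \sum_(t : m.-tuple bool | good a b t) f (count id t).

Lemma big_tupleS (T : finType) (m : nat) (P : pred (seq T)) (F : seq T -> nat) :
  \sum_(t : m.+1.-tuple T | P t) F t =
  \sum_(c : T) \sum_(t : m.-tuple T | P (c :: t)) F (c :: t).
Proof.
rewrite pair_big_dep /=.
rewrite (reindex (fun p : T * m.-tuple T => cons_tuple p.1 p.2)) //=.
exists (fun t => (thead t, behead_tuple t)) => [[c t] _|t _] /=.
  by congr pair; apply/val_inj.
by rewrite [RHS]tuple_eta; apply/val_inj.
Qed.

Lemma good_sumS (f : nat -> nat) (a b : bool) (m : nat) :
  good_sum f a b m.+1 =
  (if b then 0 else good_sum (f \o succn) b true m) +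
  (if a || b then good_sum f b false m else 0).
Proof.
rewrite /good_sum (@big_tupleS bool m (good a b) (fun s => f (count id s))).
rewrite big_bool /= andbT andbF orbT orbF; congr addn.
  by case: b; rewrite ?orbT //= big_pred0.
by case: (a || b); rewrite //= big_pred0.
Qed.

(** The first set bit is at the first or second place; the bit after it must be unset, which
    restores the state [true, false] with [m.+1] or [m] bits left. *)
Lemma good_sum_rec (f : nat -> nat) (m : nat) :
  good_sum f true false m.+3 =
  good_sum (f \o succn) true false m.+1 + good_sum (f \o succn) true false m.
Proof.
rewrite !(good_sumS f) /= !(good_sumS (f \o succn)) /=.
by rewrite !addn0 !add0n.
Qed.

Lemma good_sum0 (f : nat -> nat) (a b : bool) :
  good_sum f a b 0 = if a || b then f 0 else 0.
Proof.
rewrite /good_sum (eq_bigl (fun=> a || b)) => [|t]; last by rewrite tuple0.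
case: (a || b); last by rewrite big_pred0.
by rewrite (big_pred1 [tuple]) // => t; apply/esym/eqP/val_inj; rewrite /= tuple0.
Qed.

End Good.

(** * Matchings and maximal matchings of paths *)

Section PathMatchings.
Local Open Scope nat_scope.

(** The index is a bare natural number; out of range the set is a singleton or empty, whence the
    side conditions [i.+1 < n]. *)
Definition path_edge (n i : nat) : {set 'I_n} :=
  [set x : 'I_n | (x == i :> nat) || (x == i.+1 :> nat)]%SET.

Lemma path_edge_inj (n i j : nat) :
  i.+1 < n -> j.+1 < n -> path_edge n i = path_edge n j -> i = j.
Proof.
move=> lti ltj /setP E.
have := E (Ordinal lti); rewrite !inE /=.
have := E (Ordinal (ltnW lti)); rewrite !inE /=.
have := E (Ordinal ltj); rewrite !inE /=.
have := E (Ordinal (ltnW ltj)); rewrite !inE /=.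
by lia.
Qed.

Lemma disjoint_path_edge (n i j : nat) :
  i.+1 < n -> j.+1 < n ->
  [disjoint path_edge n i & path_edge n j]%B = [&& i != j, i.+1 != j & j.+1 != i].
Proof.
move=> lti ltj; apply/pred0P/idP => [E|h x].
  have := E (Ordinal lti); rewrite /= !inE /=.
  have := E (Ordinal (ltnW lti)); rewrite /= !inE /=.
  by lia.
by rewrite /= !inE; lia.
Qed.

Lemma card_path_edge (n i : nat) : i.+1 < n -> #|path_edge n i| = 2.
Proof.
move=> lti; have -> : path_edge n i = [set Ordinal (ltnW lti); Ordinal lti]%SET.
  by apply/setP => x; rewrite !inE -!val_eqE.
by rewrite cards2 -val_eqE /= neq_ltn ltnSn.
Qed.

Lemma edgesP (n : nat) (e : {set 'I_n}) :
  reflect (exists2 i, i.+1 < n & e = path_edge n i)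
          (e \in edges (path_graph n)).
Proof.
apply: (iffP imsetP) => [[[x y]]|[i lti ->]].
  rewrite inE /= /path_adj /= => /orP[] /eqP xy ->.
    by exists x; [rewrite xy|apply/setP => z; rewrite !inE -!val_eqE /= -xy].
  by exists y; [rewrite xy|apply/setP => z; rewrite !inE -!val_eqE /= -xy orbC].
exists (Ordinal (ltnW lti), Ordinal lti); first by rewrite inE /= /path_adj /= eqxx.
by apply/setP => x; rewrite !inE -!val_eqE.
Qed.

Lemma path_matchingP (n : nat) (M : {set {set 'I_n}}) :
  reflect (M \subset edges (path_graph n) /\
           forall i, i.+2 < n -> path_edge n i \in M -> path_edge n i.+1 \notin M)
          (matching (G := path_graph n) M).
Proof.
apply: (iffP andP) => -[sub triv]; split=> //.
  move=> i lti iM; apply/negP => jM.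
  have : path_edge n i != path_edge n i.+1.
    by apply/eqP => /(path_edge_inj (ltnW lti) lti); lia.
  move/(finset.trivIsetP triv _ _ iM jM).
  by rewrite disjoint_path_edge ?eqxx ?andbF //; lia.
apply/finset.trivIsetP => e e' eM e'M.
case/edgesP: (fintype.subsetP sub _ eM) => i lti ei.
case/edgesP: (fintype.subsetP sub _ e'M) => j ltj ej.
move=> ne; rewrite ei ej disjoint_path_edge //; apply/and3P; split.
- by apply: contraNneq ne => ij; rewrite ei ej ij.
- apply/eqP => ij; move: (triv i); rewrite ij -ei -ej => /(_ ltj eM).
  by rewrite e'M.
- apply/eqP => ji; move: (triv j); rewrite ji -ei -ej => /(_ lti e'M).
  by rewrite eM.
Qed.

(** An edge neither selected nor adjacent to a selected one could be added to [M]; conversely, any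
    edge added to [M] would meet a selected one. *)
Lemma path_maximal_matchingP (n : nat) (M : {set {set 'I_n}}) :
  reflect (matching (G := path_graph n) M /\
           forall i, i.+1 < n ->
             exists2 j, path_edge n j \in M & [&& j <= i.+1, i <= j.+1 & j.+1 < n])
          (maximal_matching (G := path_graph n) M).
Proof.
apply: (iffP maxsetP) => [[mM maxM]|[mM dom]]; split=> //.
  move=> i lti; have [iM|iNM] := boolP (path_edge n i \in M).
    by exists i; rewrite // lti !leqnSn.
  have /path_matchingP[sub indep] := mM.
  have : ~~ matching (G := path_graph n) (path_edge n i |: M)%SET.
    apply: contra iNM => /maxM <-; first by rewrite !inE eqxx.
    exact: finset.subsetUr.
  apply: contraNP => noj; apply/path_matchingP; split.
    by rewrite finset.subUset sub andbT finset.sub1set; apply/edgesP; exists i.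
  have far k : k.+1 < n -> k <= i.+1 -> i <= k.+1 -> path_edge n k \notin M.
    by move=> ? ? ?; apply/negP => kM; apply: noj; exists k => //; apply/and3P.
  move=> k ltk; rewrite !inE => /orP[/eqP|] kM; rewrite negb_or.
    have ki : k = i by apply: path_edge_inj kM => //; lia.
    rewrite {}ki in ltk *.
    rewrite (far i.+1) ?andbT //; try lia.
    by apply/eqP => /path_edge_inj E; have := E ltac:(lia) ltac:(lia); lia.
  rewrite indep // andbT; apply/eqP => /path_edge_inj E.
  by move: kM; apply/negP/far; have := E ltac:(lia) ltac:(lia); lia.
move=> B /path_matchingP[subB indepB] MB.
apply/eqP; rewrite eq_sym finset.eqEsubset MB /=; apply/fintype.subsetP => e eB.
case/edgesP: (fintype.subsetP subB _ eB) => i lti ei.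
have [j jM /and3P[ji ij ltj]] := dom i lti.
have jB := fintype.subsetP MB _ jM.
have [-> | ne] := eqVneq e (path_edge n j) => //.
have {}ne : i != j by apply: contraNneq ne => <-; rewrite ei.
have [ij'|ji'] : j = i.+1 \/ i = j.+1 by lia.
  by move: (indepB i); rewrite -ij' -ei jB => /(_ ltj eB).
by move: (indepB j); rewrite -ji' -ei eB => /(_ lti jB).
Qed.

Lemma nu_path (n : nat) : nu (path_graph n) = n./2.
Proof.
apply/eqP; rewrite eqn_leq; apply/andP; split.
  apply/bigmax_leqP => M /andP[sub triv].
  have : \sum_(e in M) #|e| = #|M| * 2.
    rewrite (eq_bigr (fun=> 2)) ?sum_nat_const // => e eM.
    by case/edgesP: (fintype.subsetP sub _ eM) => i lti ->; exact: card_path_edge.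
  have := max_card (finset.cover M); rewrite card_ord -(eqP triv).
  by move=> le_n E; rewrite E in le_n; lia.
(* Every other edge, starting from the first, attains the bound. *)
pose M := [set path_edge n i.*2 | i : 'I_n./2]%SET.
have lt2 (i : 'I_n./2) : i.*2.+1 < n by have := ltn_ord i; lia.
have card_M : #|M| = n./2.
  rewrite card_imset ?card_ord // => i j /path_edge_inj E.
  by apply: val_inj => /=; have := E (lt2 i) (lt2 j); lia.
rewrite -card_M; apply: (@leq_bigmax_cond _ (@matching (path_graph n))).
apply/path_matchingP; split.
  by apply/fintype.subsetP => e /imsetP[i _ ->]; apply/edgesP; exists i.*2.
move=> i lti /imsetP[j _ /path_edge_inj Ej]; apply/imsetP => -[k _ /path_edge_inj Ek].
by have := Ej (ltnW lti) (lt2 j); have := Ek lti (lt2 k); lia.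
Qed.

(** The bits are the indicator of [M] on the [m] edges of the path; [h] and [g] are the two
    directions of this correspondence. *)
Lemma path_maximal_sum (f : nat -> nat) (m : nat) :
  \sum_(M | maximal_matching (G := path_graph m.+1) M) f #|M| =
  good_sum f true false m.
Proof.
pose h (t : m.-tuple bool) := [set path_edge m.+1 i | i : 'I_m & tnth t i]%SET.
pose g (M : {set {set 'I_m.+1}}) := [tuple path_edge m.+1 i \in M | i < m].
have mem_h t i : i < m -> (path_edge m.+1 i \in h t) = nth false t i.
  move=> lti; apply/imsetP/idP => [[j]|ti].
    rewrite inE (tnth_nth false) => tj /path_edge_inj -> //.
    by rewrite ltnS.
  by exists (Ordinal lti); rewrite // inE (tnth_nth false).
have gK t : g (h t) = t.
  by apply: eq_from_tnth => i; rewrite tnth_mktuple mem_h // (tnth_nth false).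
rewrite (reindex_onto h g) => [|M /path_maximal_matchingP[/andP[sub _] _]]; last first.
  apply/setP => e; apply/imsetP/idP => [[i]|eM].
    by rewrite inE tnth_mktuple => iM ->.
  case/edgesP: (fintype.subsetP sub _ eM) => i lti ei.
  by exists (Ordinal (lti : i < m)); rewrite // inE tnth_mktuple /= -ei.
apply: eq_big => [t|t _]; last first.
  congr f; rewrite card_in_imset => [|i j _ _ /path_edge_inj ij]; last first.
    by apply/val_inj/ij; rewrite ltnS.
  rewrite -sum1_card -sum1_count big_tuple.
  by apply: eq_bigl => i; rewrite inE.
rewrite gK eqxx andbT.
apply/path_maximal_matchingP/goodP => [[/path_matchingP[_ indep] dom]|[indep dom]].
  rewrite size_tuple; split=> -[|i] //= lti.
    rewrite -!mem_h ?(ltnW lti) //; apply/negP => /andP[iM].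
    by apply/negP/indep.
  have [j] := dom i lti; rewrite ltnS => + /and3P[ji ij ltj].
  rewrite mem_h // => tj.
  have /or3P[/eqP jE|/eqP jE|/eqP iE] : [|| j == i, j == i.+1 | i == j.+1] by lia.
  - by rewrite -jE tj orbT.
  - by rewrite -jE tj !orbT.
  - by rewrite iE /= tj.
move: indep dom; rewrite size_tuple => indep dom; split.
  apply/path_matchingP; split.
    by apply/fintype.subsetP => e /imsetP[i _ ->]; apply/edgesP; exists i; rewrite // ltnS.
  move=> i lti; have lti' := ltnW lti; have := indep i.+1 lti.
  by rewrite /= -!mem_h // negb_and => /orP[/negPf->|].
(* Because of the prepended bits, position [i.+1] tests the edges [i - 1], [i] and [i + 1]. *)
move=> i; rewrite ltnS => lti; have /= := dom i.+1 lti.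
case/or3P.
- case: i lti => //= i lti ti; exists i; first by rewrite mem_h // ltnW.
  by lia.
- by move=> ti; exists i; rewrite ?mem_h //; lia.
- move=> ti; have [lti'|] := ltnP i.+1 m; last first.
    by move=> le; rewrite nth_default ?size_tuple in ti.
  by exists i.+1; rewrite ?mem_h //; lia.
Qed.

End PathMatchings.

(** * The plastic number *)

Section Plastic.
Variable R : realType.
Let r := plastic R.

(** Cardano: the two cube roots satisfy [a^3 + b^3 = 1] and [a * b = 1/3]. *)
Lemma plasticE : r ^+ 3 = r + 1.
Proof.
rewrite /r /plastic.
have s69 : Num.sqrt 69 ^+ 2 = 69 :> R by rewrite sqr_sqrtr.
have s0 : 0 <= Num.sqrt 69 :> R by exact: sqrtr_ge0.
have s9 : Num.sqrt 69 <= 9 :> R by nra.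
have cube (x : R) : 0 <= x -> (x `^ 3^-1) ^+ 3 = x.
  by move=> x0; rewrite -powR_mulrn ?powR_ge0 // -powRrM mulVf ?powRr1 // pnatr_eq0.
set a := _ `^ _; set b := _ `^ _.
have a3 : a ^+ 3 = (9 + Num.sqrt 69) / 18 by apply: cube; lra.
have b3 : b ^+ 3 = (9 - Num.sqrt 69) / 18 by apply: cube; lra.
have ab : a * b = 3^-1.
  have ab0 : 0 <= a * b by rewrite mulr_ge0 // powR_ge0.
  apply: (@pexpIrn _ 3) => //; rewrite ?nnegrE ?invr_ge0 //.
  by rewrite exprMn a3 b3; field: s69.
have -> : (a + b) ^+ 3 = a ^+ 3 + b ^+ 3 + 3 * (a * b) * (a + b) by ring.
by rewrite a3 b3 ab; field.
Qed.

Lemma plastic_bounds : 6 / 5 < r < 2.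
Proof.
have r3 := plasticE.
have r0 : 0 <= r by rewrite addr_ge0 // powR_ge0.
apply/andP; split; rewrite ltNge; apply/negP => h.
  have h2 : r ^+ 2 <= 36 / 25 by nra.
  by have : r * r ^+ 2 <= r * (36 / 25) by [exact: ler_wpM2l]; rewrite -exprS r3; lra.
have h2 : 4 <= r ^+ 2 by nra.
by have : r * 4 <= r * r ^+ 2 by [exact: ler_wpM2l]; rewrite -exprS r3; lra.
Qed.

Lemma plastic_unique (x : R) : x ^+ 3 = x + 1 <-> x = r.
Proof.
split=> [x3|->]; last exact: plasticE.
have r3 := plasticE; have /andP[r_gt _] := plastic_bounds.
have /eqP : (x - r) * (x ^+ 2 + x * r + r ^+ 2 - 1) = 0 by ring: x3 r3.
rewrite mulf_eq0 subr_eq0 => /orP[/eqP //|/eqP q0].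
(* The cofactor is [(x + r/2)^2 + (3 r^2 / 4 - 1)], positive since [r > 6/5]. *)
by have := sqr_ge0 (x + r / 2); nra.
Qed.

(** * Asymptotics of the recurrences; [t n] and [s n] stand for [T0] and [T1] of the path on [n.+1]
    vertices *)

Variables t s : nat -> R.
Hypotheses (t0 : t 0%N = 1) (t1 : t 1%N = 1) (t2 : t 2 = 2).
Hypothesis t_rec : forall n, t n.+3 = t n.+1 + t n.
Hypothesis s_rec : forall n, s n.+3 = s n.+1 + s n + t n.+1 + t n.

(** Chosen so that [c * n * r^n] solves the recurrence of [s] when [t n = r^n]: this asks
    [c * (3 r^3 - r) = r + 1]. *)
Let c : R := (r + 1) / (2 * r + 3).
(** Vanishes on [r^n], leaving the part of [t] due to the two complex roots. *)
Let u n := t n.+1 - r * t n.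

Lemma t_ge1 n : 1 <= t n.
Proof.
have : (1 <= t n) && (1 <= t n.+1) && (1 <= t n.+2).
  elim: n => [|n /andP[/andP[h0 h1] h2]]; first by rewrite t0 t1 t2; lra.
  by rewrite h1 h2 t_rec; lra.
by move=> /andP[/andP[]].
Qed.

(* [x^3 - x - 1 = (x - r) (x^2 + r x + 1/r)], and the quadratic factor has
   negative discriminant, so the form [v^2 + r u v + u^2 / r] is definite;
   it is divided by [r] at each step. *)
Lemma t_deviation_bounded : exists K : R, 0 <= K /\ forall n, `|u n| <= K.
Proof.
have r3 := plasticE; have /andP[r_gt r_lt] := plastic_bounds.
have r_neq0 : r != 0 by lra.
pose Q n := u n.+1 ^+ 2 + r * u n * u n.+1 + u n ^+ 2 / r.
have u_rec n : u n.+2 = - (r * u n.+1) - u n / r.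
  by rewrite /u t_rec; field: r3.
have QS n : Q n.+1 = Q n / r.
  by rewrite /Q u_rec; field.
have Q_ge n : u n ^+ 2 * (r^-1 - r ^+ 2 / 4) <= Q n.
  rewrite -subr_ge0 (_ : _ - _ = (u n.+1 + r * u n / 2) ^+ 2) ?sqr_ge0 //.
  by rewrite /Q; field.
pose d := r^-1 - r ^+ 2 / 4.
have d_gt0 : 0 < d.
  have -> : d = (3 - r) / (4 * r) by rewrite /d; field: r3.
  by apply: divr_gt0; lra.
have Q_ge0 n : 0 <= Q n.
  by apply: le_trans (Q_ge n); rewrite mulr_ge0 ?sqr_ge0 // ltW.
have Q_le n : Q n <= Q 0%N.
  elim: n => // n; apply: le_trans; rewrite QS ler_pdivrMr; last lra.
  by rewrite ler_peMr //; lra.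
(* The added 1 avoids a square root: [x^2 <= A] gives [x <= A + 1]. *)
exists (Q 0%N / d + 1); split=> [|n].
  by rewrite addr_ge0 // divr_ge0 // ltW.
have : u n ^+ 2 <= Q 0%N / d by rewrite ler_pdivlMr // (le_trans (Q_ge n)).
by rewrite -(real_normK (num_real (u n))); have := normr_ge0 (u n); nra.
Qed.

Lemma s_asymptotic :
  exists C : R, 0 <= C /\ forall n, `|s n - c * n%:R * t n| <= C * t n.
Proof.
have r3 := plasticE; have /andP[r_gt r_lt] := plastic_bounds.
have [K [K0 uK]] := t_deviation_bounded.
pose e n := s n - c * n%:R * t n.
have e_rec n : e n.+3 = e n.+1 + e n + u n / (2 * r + 3).
  rewrite /e s_rec t_rec /u /c -[n.+3]addn3 -[n.+1]addn1 !natrD.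
  by field; lra.
have du n : `|u n / (2 * r + 3)| <= K.
  rewrite normrM normfV (@ger0_norm _ (2 * r + 3)); last lra.
  rewrite ler_pdivrMr; last lra.
  by have := uK n; nra.
pose C := `|e 0%N| + `|e 1%N| + `|e 2| + K.
have [[e0 e1] e2] := (normr_ge0 (e 0%N), normr_ge0 (e 1%N), normr_ge0 (e 2)).
(* The extra [K] closes the induction: two hypotheses supply two copies, one absorbs the forcing
   term and one remains. *)
have eC n : `|e n| + K <= C * t n.
  suff : [&& `|e n| + K <= C * t n, `|e n.+1| + K <= C * t n.+1
           & `|e n.+2| + K <= C * t n.+2] by case/and3P.
  elim: n => [|n /and3P[h0 h1 h2]].
    by rewrite t0 t1 t2 /C; apply/and3P; split; lra.
  rewrite h1 h2 /= e_rec t_rec.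
  have := du n; have := ler_normD (e n.+1 + e n) (u n / (2 * r + 3)).
  by have := ler_normD (e n.+1) (e n); lra.
exists C; split=> [|n]; first by rewrite /C; lra.
by have := eC n; rewrite /e; lra.
Qed.

Lemma ratio_bound : exists C : R, forall n,
  `|s n.+1 / (n.+2./2%:R * t n.+1) - (2 * r + 2) / (2 * r + 3)| <= C * n.+1%:R^-1.
Proof.
have /andP[r_gt r_lt] := plastic_bounds.
have [C [C0 sC]] := s_asymptotic.
exists (3 * (C + c)) => n.
set k := n.+2./2.
have k_gt0 : 0 < k%:R :> R by rewrite ltr0n /k.
have /andP[k_ge k_le] : (n.+1%:R : R) <= 2 * k%:R <= (n.+2%:R : R).
  by apply/andP; split; rewrite -natrM ler_nat /k; lia.
have c0 : 0 <= c by rewrite /c divr_ge0; lra.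
have t_ge1n := t_ge1 n.+1.
have -> : (2 * r + 2) / (2 * r + 3) = 2 * c by rewrite /c; field; lra.
(* Separates the error of [s] from the rounding in [k]; each part is [O(1 / k)]. *)
have -> : s n.+1 / (k%:R * t n.+1) - 2 * c =
   (s n.+1 - c * n.+1%:R * t n.+1) / (k%:R * t n.+1) - c * (2 * k%:R - n.+1%:R) / k%:R.
  by field; apply/andP; split; lra.
apply: le_trans (ler_normB _ _) _.
have le1 : `|(s n.+1 - c * n.+1%:R * t n.+1) / (k%:R * t n.+1)| <= C / k%:R.
  rewrite normrM normfV (@ger0_norm _ (k%:R * t n.+1)); last by rewrite mulr_ge0; lra.
  rewrite ler_pdivrMr; last by rewrite mulr_gt0; lra.
  rewrite [leRHS](_ : _ = C * t n.+1) //.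
  by field; lra.
have le2 : `|c * (2 * k%:R - n.+1%:R) / k%:R| <= c / k%:R.
  have k_sub : 0 <= 2 * k%:R - n.+1%:R :> R by rewrite subr_ge0.
  rewrite ger0_norm; last exact: divr_ge0 (mulr_ge0 c0 k_sub) (ltW k_gt0).
  rewrite ler_pM2r ?invr_gt0 //.
  rewrite ler_piMr //.
  by move: k_le; rewrite -[n.+2]addn1 natrD; lra.
apply: le_trans (lerD le1 le2) _.
rewrite -mulrDl -mulrA mulrCA ler_wpM2l //; first lra.
rewrite ler_pdivlMr ?ltr0n // mulrC ler_pdivrMr //; lra.
Qed.

End Plastic.

(** * Recurrences for [T0] and [T1] of paths *)

Section Recurrences.
Local Open Scope nat_scope.

Lemma T0_path (m : nat) : T0 (path_graph m.+1) = good_sum (fun=> 1) true false m.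
Proof.
by rewrite -path_maximal_sum /T0 -sum1_card; apply: eq_bigl => M; rewrite inE.
Qed.

Lemma T1_path (m : nat) : T1 (path_graph m.+1) = good_sum id true false m.
Proof. exact: (path_maximal_sum id). Qed.

Lemma T0_path_rec (m : nat) :
  T0 (path_graph m.+4) = T0 (path_graph m.+2) + T0 (path_graph m.+1).
Proof. by rewrite !T0_path good_sum_rec. Qed.

Lemma T1_path_rec (m : nat) :
  T1 (path_graph m.+4) = T1 (path_graph m.+2) + T1 (path_graph m.+1)
                         + T0 (path_graph m.+2) + T0 (path_graph m.+1).
Proof.
(* The edge split off adds 1 to each size, which produces the [T0] terms. *)
have S k : good_sum succn true false k =
    good_sum id true false k + good_sum (fun=> 1) true false k.
  by rewrite -big_split /=; apply: eq_bigr => t _; rewrite addn1.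
rewrite !T1_path !T0_path good_sum_rec -/succn !S; lia.
Qed.

End Recurrences.

Theorem theorem2 (R : realType) :
  (forall x : R, x ^+ 3 = x + 1 <-> x = plastic R) /\
  (Iratio (path_graph n) R @[n --> \oo] -->
     (2 * plastic R + 2) / (2 * plastic R + 3)).
Proof.
split; first exact: plastic_unique.
have [|||||C IC] := @ratio_bound R (fun m => (T0 (path_graph m.+1))%:R)
  (fun m => (T1 (path_graph m.+1))%:R).
- by rewrite /= T0_path good_sum0.
- by rewrite /= T0_path good_sumS !good_sum0.
- by rewrite /= T0_path !good_sumS /= !good_sum0.
- by move=> m; rewrite /= T0_path_rec natrD.
- by move=> m; rewrite /= T1_path_rec !natrD.
(* The shift skips the paths on 0 and 1 vertices, where [nu] is 0 and the ratio is 1 by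
   convention. *)
rewrite -(cvg_shiftn 2) /=; apply/cvgrPdist_le => eps eps_gt0.
have : C * m.+1%:R^-1 @[m --> \oo] --> C * 0.
  by apply: cvgMr; exact: cvg_harmonic.
rewrite mulr0 => /cvgrPdist_le /(_ _ eps_gt0); apply: filterS => m.
rewrite sub0r normrN => le_eps; rewrite distrC addn2 /Iratio nu_path /=.
exact: le_trans (IC m) (le_trans (ler_norm _) le_eps).
Qed.
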